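(* Suppose $\tau_1$ is a compactly supported probability measure on $(0,\infty)$ and $\tau_2$ is a compactly supported probability measure on $\mathbb{R}$. Let $\mu$ be a probability measure on the real line chosen randomly by selecting the sequence of off-diagonal Jacobi parameters $\{a_n\}_{n\in\mathbb{N}}$ as i.i.d. random variables with distribution $\tau_1$ and diagonal Jacobi parameters $\{b_n\}_{n\in\mathbb{N}}$ as i.i.d. random variables with distribution $\tau_2$. Then almost surely it is true that for every $\nu$ in the class $K(\tau_1,\tau_2)$, there exists a subsequence $\{m_n\}_{n=1}^{\infty}\subseteq\mathbb{N}$ such that $$\lim_{n\to\infty}\left(\frac{p_{m_n-1}(z;\mu)}{p_{m_n}(z;\mu)}-\frac{p_{n-1}(z;\nu)}{p_{n}(z;\nu)}\right)=0,\qquad|z|>\max\{R_{\mu},R_{\nu}\}.$$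
   Context: For a probability measure $\mu$ with compact and infinite support in the complex plane, $\{p_n(z;\mu)\}_{n\ge0}$ denotes the sequence of orthonormal polynomials: $p_n(\cdot;\mu)$ has degree $n$, positive leading coefficient, and $\int p_n(z;\mu)\overline{p_m(z;\mu)}\,d\mu(z)=\delta_{m,n}$. Set $R_\mu=\sup\{|z|:z\in\mathrm{supp}(\mu)\}$. If $\mathrm{supp}(\mu)\subseteq\mathbb{R}$, the matrix $M_\mu$ (rows and columns indexed by $\{1,2,\ldots\}$) of multiplication by $z$ in the basis $\{p_n(\cdot;\mu)\}_{n\ge0}$ of the closure of the polynomials in $L^2(\mu)$ is symmetric and tridiagonal. Its Jacobi parameters $\{a_n,b_n\}_{n\ge1}$ are the diagonal entries $b_n=(M_\mu)_{n,n}\in\mathbb{R}$ and the off-diagonal entries $a_n=(M_\mu)_{n+1,n}=(M_\mu)_{n,n+1}>0$. Favard's Theorem gives a one-to-one correspondence between bounded sequences of Jacobi parameters ($a_n>0$, $b_n\in\mathbb{R}$) and compactly supported probability measures on $\mathbb{R}$ with infinite support, so a random choice of Jacobi parameters determines a random measure. The class $K(\tau_1,\tau_2)$ is the set of all probability measures on the real line whose Jacobi parameters $\{a_n,b_n\}_{n\in\mathbb{N}}$ satisfy $a_n\in\mathrm{supp}(\tau_1)$ and $b_n\in\mathrm{supp}(\tau_2)$ for all $n\in\mathbb{N}$. *)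

(* Defs.v *)
From HB Require Import structures.
From mathcomp Require Export all_boot all_order all_algebra.
From mathcomp Require Export complex.
From mathcomp Require Export all_classical all_reals all_analysis.

Set Implicit Arguments.
Unset Strict Implicit.
Unset Printing Implicit Defensive.

Export Order.TTheory GRing.Theory Num.Theory.
Export numFieldNormedType.Exports.

Global Open Scope classical_set_scope.
Global Open Scope complex_scope.
Global Open Scope ring_scope.

Notation probabilityR R := (probability (measurableTypeR R) R).

Definition supp (R : realType) (mu : probabilityR R) : set R :=
  [set x | forall e : R, 0 < e -> (0 < mu (ball x e))%E].

Definition supp_radius (R : realType) (mu : probabilityR R) : R :=
  sup [set `|x| | x in supp mu].

Definition integralC (R : realType) (mu : probabilityR R) (f : R -> R[i]) :
    R[i] :=
  (\int[mu]_(x in setT) complex.Re (f x))%R +i*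
  (\int[mu]_(x in setT) complex.Im (f x))%R.

Definition orthonormal_polys (R : realType) (mu : probabilityR R)
    (p : nat -> {poly R[i]}) : Prop :=
  [/\ forall n, size (p n) = n.+1,
      forall n, 0 < lead_coef (p n) &
      forall m n, integralC mu (fun x => (p n).[x%:C] * ((p m).[x%:C])^*%C)
                  = (m == n)%:R].

(* There is exactly one such sequence when the support of [mu] is compact and
   infinite; the default value 0 is only reached outside this case. *)
Definition opoly (R : realType) (mu : probabilityR R) : nat -> {poly R[i]} :=
  xget (fun=> 0) [set p | orthonormal_polys mu p].

(* Rows and columns are indexed from 0: [jacobi_mx mu i j] is the entry
   (i+1, j+1) of the usual matrix, i.e. the coefficient <z p_j, p_i>. *)
Definition jacobi_mx (R : realType) (mu : probabilityR R) (i j : nat) : R[i] :=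
  integralC mu
    (fun x => x%:C * (opoly mu j).[x%:C] * ((opoly mu i).[x%:C])^*%C).

(* [a n] and [b n] are the parameters usually written a_(n+1) and b_(n+1). *)
Definition jacobi_parameters (R : realType) (mu : probabilityR R)
    (a b : nat -> R) : Prop :=
  [/\ compact (supp mu), infinite_set (supp mu),
      forall n, jacobi_mx mu n n = (b n)%:C,
      forall n, jacobi_mx mu n.+1 n = (a n)%:C &
      forall n, jacobi_mx mu n n.+1 = (a n)%:C].

Definition classK (R : realType) (tau1 tau2 : probabilityR R) :
    set (probabilityR R) :=
  [set nu | exists a b : nat -> R,
     [/\ jacobi_parameters nu a b,
         forall n, supp tau1 (a n) & forall n, supp tau2 (b n)]].

Definition mutually_independent (R : realType) (d : measure_display)
    (T : measurableType d) (P : probability T R) (I : eqType)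
    (X : I -> {RV P >-> measurableTypeR R}) : Prop :=
  forall (s : seq I) (B : I -> set (measurableTypeR R)),
    uniq s -> (forall i, measurable (B i)) ->
    P (\bigcap_(i in [set` s]) (X i @^-1` B i)) =
    (\prod_(i <- s) P (X i @^-1` B i))%E.

Definition sum_fam (A : Type) (u v : nat -> A) (i : nat + nat) : A :=
  match i with inl n => u n | inr n => v n end.

(* Only n >= 1 is meaningful (0.-1 = 0). *)
Definition ratio (R : realType) (mu : probabilityR R) (n : nat) (z : R[i]) :
    R[i] :=
  (opoly mu n.-1).[z] / (opoly mu n).[z].

(* Main.v *)
Require Import Defs.
From mathcomp Require Import ring lra zify measurable_realfun.
Import ComplexField.Normc.

Set Implicit Arguments.
Unset Strict Implicit.
Unset Printing Implicit Defensive.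

(** Write p_k and q_k for the orthonormal polynomials of [mu w] and of [nu],
    a, b and a', b' for their Jacobi parameters, and evaluate everything at a
    point z with |z| larger than both radii.

    Probability only enters through one fact ([shadows_ae]): almost surely,
    every finite block of values a'_0, ..., a'_(n-1), b'_0, ..., b'_(n-1) taken
    in the supports of tau1 and tau2 is reproduced by the random parameters, up
    to any error e > 0, at positions M, ..., M+n-1 with M as large as desired.
    This is the second Borel-Cantelli lemma applied to disjoint blocks of
    indices, made uniform in the target block by restricting to rational
    centres and radii, of which there are countably many. The index m_n is the
    end of such a block of length n with error 1/(n+1)^2.

    It remains to see that the ratio p_(M+k)/p_(M+k+1) of consecutive values
    forgets the parameters that precede the block. Consider the Casoratian
    W_k = a'_k p_(M+k) q_(k+1) - a_(M+k) p_(M+k+1) q_k. Dividing it by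
    p_(M+k+1) q_(k+1) gives the difference of the two ratios, up to the factor
    a'_k (bounded below, because supp tau1 lies away from 0) and the small
    error a_(M+k) - a'_k. The two recurrences make W_(k+1) - W_k a combination
    of the differences a - a' and b - b' with coefficients p_i q_j
    ([casoratianS]), and in W_0 the values of q are the fixed q_0 and q_1. So
    everything follows ([ratio_diff_le]) from two properties of the values
    outside the disc of radius R = sup |supp mu|, valid for q as well as p:
    |p_i| <= C |p_j| for all i <= j, and |p_n| -> oo.

    Both are elementary consequences ([energy_le], [energy_growth]) of the
    energy inequality ([orthonormal_energy])
       (|z| - R) * sum_(k <= n) |p_k|^2 <= R |p_(n+1)| |p_n|.
    To prove it, let K = sum_(k <= n) conj(p_k(z)) p_k be the reproducing
    kernel at z. By the Christoffel-Darboux formula <xK, K> - conj(z) <K, K>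
    equals - a_n conj(p_(n+1)(z)) p_n(z), while <K, K> is the sum on the left,
    and both |<xK, K>| <= R <K, K> and |a_n| <= R hold because mu is carried by
    [-R, R]. *)

(** * The modulus of a complex number *)

Lemma normc_ge0 (R : rcfType) (x : R[i]) : 0 <= normc x.
Proof. by case: x => u v; rewrite sqrtr_ge0. Qed.

Lemma normc_real (R : rcfType) (x : R) : normc x%:C = `|x|.
Proof. by rewrite /normc /= expr0n /= addr0 sqrtr_sqr. Qed.

Lemma normc_conj (R : rcfType) (x : R[i]) : normc x^*%C = normc x.
Proof. by case: x => u v; rewrite /normc /= sqrrN. Qed.

Lemma mulc_conj (R : rcfType) (x : R[i]) : x * x^*%C = (normc x ^+ 2)%:C.
Proof.
case: x => u v; rewrite /normc sqr_sqrtr ?addr_ge0 ?sqr_ge0 //.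
by apply/eqP; rewrite eq_complex /=; apply/andP; split; apply/eqP; ring.
Qed.

(** * Sequences whose energy is controlled by two consecutive terms *)

(** The sequence [u] stands for the moduli of the values of orthonormal
    polynomials at a point outside the disc carrying the measure. *)
Section Energy.
Variables (R : realType) (u : nat -> R) (A d : R).
Hypotheses (d0 : 0 < d) (A0 : 0 <= A).
Hypotheses (u0 : 0 < u 0%N) (u_ge0 : forall n, 0 <= u n).
Hypothesis energy :
  forall n, d * \sum_(k < n.+1) u k ^+ 2 <= A * (u n.+1 * u n).

Let sum_ge k n : (k <= n)%N -> u k ^+ 2 <= \sum_(i < n.+1) u i ^+ 2.
Proof.
move=> kn; rewrite (bigD1 (Ordinal (kn : (k < n.+1)%N))) //= lerDl.
by apply: sumr_ge0 => i _; rewrite exprn_ge0.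
Qed.

Lemma energy_gt0 n : 0 < u n.
Proof.
case: n => // n; rewrite lt_neqAle u_ge0 andbT; apply/negP => /eqP un0.
have := energy n; rewrite -un0 mul0r mulr0 leNgt => /negP; apply.
by rewrite mulr_gt0 // (lt_le_trans _ (sum_ge (leq0n n)))// exprn_gt0.
Qed.

(** Bounding the energy below by [u n ^+ 2] gives [u n <= A / d * u n.+1];
    bounding it below by [u k ^+ 2] and using the previous inequality on the
    right gives [u k <= A / d * u n.+1]. The summand 1 covers [k = n]. *)
Lemma energy_le k n : (k <= n)%N -> u k <= (1 + A / d) * u n.
Proof.
have Ad : 0 <= A / d by rewrite divr_ge0 // ltW.
have AdE : A / d * d = A by rewrite divfK // gt_eqF.
have le1 i : u i <= (1 + A / d) * u i by rewrite mulrDl mul1r lerDl mulr_ge0.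
case: n => [|n]; first by rewrite leqn0 => /eqP ->.
rewrite leq_eqVlt => /orP[/eqP -> //|]; rewrite ltnS => kn.
have un := energy_gt0 n; have un1 := energy_gt0 n.+1; have uk := energy_gt0 k.
have lastE : u n <= A / d * u n.+1.
  have H := le_trans (ler_wpM2l (ltW d0) (sum_ge (leqnn n))) (energy n).
  rewrite -(ler_pM2r (mulr_gt0 d0 un)).
  have -> : A / d * u n.+1 * (d * u n) = A / d * d * (u n.+1 * u n) by ring.
  rewrite AdE; apply: le_trans H; rewrite le_eqVlt; apply/orP; left.
  by apply/eqP; ring.
have sqE : u k ^+ 2 <= (A / d * u n.+1) ^+ 2.
  have H := le_trans (ler_wpM2l (ltW d0) (sum_ge kn)) (energy n).
  rewrite -(ler_pM2r d0) mulrC.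
  apply: (le_trans (y := A * (u n.+1 * (A / d * u n.+1)))).
    by apply: (le_trans H); rewrite ler_wpM2l // ler_wpM2l // ltW.
  have -> : (A / d * u n.+1) ^+ 2 * d =
    A / d * d * (u n.+1 * (A / d * u n.+1)) by ring.
  by rewrite AdE.
rewrite ler_pXn2r ?nnegrE ?(mulr_ge0 Ad (ltW un1)) ?(ltW uk) // in sqE.
by apply: (le_trans sqE); rewrite ler_wpM2r // lerDr.
Qed.

(** By [energy_le] no term is smaller than [u 0 / C], so the energy of the
    first terms grows at least linearly; it is at most [A * C * u n ^+ 2]. *)
Lemma energy_growth : exists2 c : R, 0 < c & forall n, c * n%:R <= u n ^+ 2.
Proof.
set C := 1 + A / d.
have Ad : 0 <= A / d by rewrite divr_ge0 // ltW.
have C0 : 0 < C by rewrite /C; lra.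
have A_gt0 : 0 < A.
  rewrite lt_neqAle A0 andbT; apply/negP => /eqP A00.
  have := energy 0; rewrite big_ord1 -A00 mul0r leNgt => /negP; apply.
  by rewrite mulr_gt0 // exprn_gt0.
have lb n : (u 0 / C) ^+ 2 <= u n ^+ 2.
  rewrite ler_pXn2r ?nnegrE ?divr_ge0 ?(ltW C0) ?(ltW u0) //.
  by rewrite ler_pdivrMr // mulrC energy_le.
exists (d * (u 0 / C) ^+ 2 / (A * C)).
  by rewrite divr_gt0 // mulr_gt0 // exprn_gt0 // divr_gt0.
case=> [|n]; first by rewrite mulr0 exprn_ge0.
rewrite mulrAC ler_pdivrMr ?mulr_gt0 //.
have sum_lb : (u 0 / C) ^+ 2 * n.+1%:R <= \sum_(k < n.+1) u k ^+ 2.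
  rewrite mulr_natr -[X in _ *+ X](card_ord n.+1) -sumr_const.
  by apply: ler_sum => i _; exact: lb.
rewrite -mulrA; apply: (le_trans (ler_wpM2l (ltW d0) sum_lb)).
apply: (le_trans (energy n)).
have := energy_le (leqnSn n); rewrite -/C => H2.
have un1 := energy_gt0 n.+1.
have -> : u n.+1 ^+ 2 * (A * C) = A * (u n.+1 * (C * u n.+1)) by ring.
by rewrite ler_wpM2l // ler_wpM2l.
Qed.

End Energy.

(** * Comparing solutions of two nearby three-term recurrences *)

Section Casoratian.
Variables (R : realType) (z : R[i]).
Variables (p q : nat -> R[i]) (a b a' b' : nat -> R).
Hypothesis p_rec : forall k,
  z * p k.+1 = (a k.+1)%:C * p k.+2 + (b k.+1)%:C * p k.+1 + (a k)%:C * p k.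
Hypothesis q_rec : forall k,
  z * q k.+1 = (a' k.+1)%:C * q k.+2 + (b' k.+1)%:C * q k.+1 + (a' k)%:C * q k.

(** The shift [M] aligns the index 0 of [q] with the index [M] of [p]. *)
Definition casoratian M k : R[i] :=
  (a' k)%:C * (p (M + k)%N * q k.+1) - (a (M + k)%N)%:C * (p (M + k).+1 * q k).

(** Eliminating the highest terms by means of both recurrences cancels the
    contributions of z. *)
Lemma casoratianS M k : casoratian M k.+1 = casoratian M k +
   ((b (M + k).+1 - b' k.+1)%:C * (p (M + k).+1 * q k.+1)
   + (a (M + k)%N - a' k)%:C *
     (p (M + k)%N * q k.+1 + p (M + k).+1 * q k)).
Proof.
rewrite /casoratian !addnS !rmorphB /=.
set x := (M + k)%N.
have -> : (a' k.+1)%:C * (p x.+1 * q k.+2) =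
  p x.+1 * ((a' k.+1)%:C * q k.+2) by ring.
have -> : (a' k.+1)%:C * q k.+2 =
  z * q k.+1 - (b' k.+1)%:C * q k.+1 - (a' k)%:C * q k by rewrite q_rec; ring.
have -> : (a x.+1)%:C * (p x.+2 * q k.+1) =
  q k.+1 * ((a x.+1)%:C * p x.+2) by ring.
have -> : (a x.+1)%:C * p x.+2 =
  z * p x.+1 - (b x.+1)%:C * p x.+1 - (a x)%:C * p x by rewrite p_rec; ring.
ring.
Qed.

Variables (C C' A A' alpha e : R) (M k : nat).
Hypotheses (C0 : 0 < C) (C'0 : 0 < C') (A0 : 0 <= A) (A'0 : 0 <= A').
Hypothesis alpha0 : 0 < alpha.
Hypothesis p_le : forall i j, (i <= j)%N -> normc (p i) <= C * normc (p j).
Hypothesis q_le : forall i j, (i <= j)%N -> normc (q i) <= C' * normc (q j).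
Hypothesis p_neq0 : forall i, 0 < normc (p i).
Hypothesis q_neq0 : forall i, 0 < normc (q i).
Hypothesis aA : forall i, `|a i| <= A.
Hypothesis a'A : forall i, `|a' i| <= A'.
Hypothesis a'alpha : forall i, alpha <= a' i.
Hypothesis close : forall i, (i <= k)%N ->
  `|a (M + i)%N - a' i| <= e /\ `|b (M + i)%N - b' i| <= e.

Let B : R := normc (p (M + k).+1) * normc (q k.+1).

Let pq_le i j : (i <= (M + k).+1)%N -> (j <= k.+1)%N ->
  normc (p i * q j) <= C * C' * B.
Proof.
move=> ik jk; rewrite normcM /B mulrACA ler_pM ?p_le ?q_le //; exact: ltW.
Qed.

Lemma casoratian_le j : (j <= k)%N ->
  normc (casoratian M j) <=
  normc (casoratian M 0) + j%:R * (3 * e * (C * C' * B)).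
Proof.
elim: j => [|j IHj] jk; first by rewrite mul0r addr0.
have [ca _] := close (ltnW jk); have [_ cb] := close jk.
rewrite casoratianS; apply: (le_trans (le_normcD _ _)).
have -> : j.+1%:R = j%:R + 1 :> R by rewrite natr1.
rewrite mulrDl mul1r addrA lerD //; first exact/IHj/ltnW.
apply: (le_trans (le_normcD _ _)).
rewrite !normcM !normc_real -!normcM.
have e0 : 0 <= e by apply: le_trans ca.
have -> : 3 * e * (C * C' * B) =
  e * (C * C' * B) + e * (C * C' * B + C * C' * B) by ring.
rewrite addnS in cb.
apply: lerD; apply: ler_pM => //.
- exact: normc_ge0.
- by apply: pq_le; lia.
- exact: normc_ge0.
- by apply: (le_trans (le_normcD _ _)); apply: lerD; apply: pq_le; lia.
Qed.

(** The first summand on the right carries the influence of the values of [p]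
    and [q] at the beginning of the block, and fades as [q k.+1] grows; the
    second one collects the mismatches inside the block. *)
Lemma ratio_diff_le :
  alpha * normc (p (M + k)%N / p (M + k).+1 - q k / q k.+1) <=
  (A' * normc (q 1%N) + A * normc (q 0%N)) * C / normc (q k.+1)
  + (k%:R * (3 * (C * C')) + C') * e.
Proof.
have pM := p_neq0 (M + k).+1; have qk := q_neq0 k.+1.
have nzP : p (M + k).+1 != 0.
  by apply/eqP => E; move: pM; rewrite E normc0 ltxx.
have nzQ : q k.+1 != 0 by apply/eqP => E; move: qk; rewrite E normc0 ltxx.
have B0 : 0 < B by rewrite mulr_gt0.
have a'0 : 0 < a' k by apply: lt_le_trans (a'alpha k).
have [ca _] := close (leqnn k).
set r := _ - _.
have key : (a' k)%:C * r = casoratian M k / (p (M + k).+1 * q k.+1)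
    + (a (M + k)%N - a' k)%:C * (q k / q k.+1).
  by rewrite /casoratian /r rmorphB /=; field; rewrite nzP nzQ.
have : alpha * normc r <= normc ((a' k)%:C * r).
  by rewrite normcM normc_real (gtr0_norm a'0) ler_wpM2r // normc_ge0.
move=> /le_trans; apply; rewrite key.
apply: (le_trans (le_normcD _ _)).
rewrite !normcM !normcV normcM normc_real.
have W0 : normc (casoratian M 0) <=
    (A' * normc (q 1%N) + A * normc (q 0%N)) * C * normc (p (M + k).+1).
  rewrite /casoratian addn0; apply: (le_trans (le_normcD _ _)).
  rewrite normcN !normcM !normc_real.
  have h1 : normc (p M) <= C * normc (p (M + k).+1) by apply: p_le; lia.
  have h2 : normc (p M.+1) <= C * normc (p (M + k).+1) by apply: p_le; lia.
  set Q := normc (p (M + k).+1) in h1 h2 *.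
  have -> : (A' * normc (q 1%N) + A * normc (q 0%N)) * C * Q =
    A' * (C * Q * normc (q 1%N)) + A * (C * Q * normc (q 0%N)) by ring.
  by apply: lerD; apply: ler_pM; rewrite ?mulr_ge0 ?normc_ge0 //;
     apply: ler_pM; rewrite ?normc_ge0.
have := le_trans (casoratian_le (leqnn k)) (lerD W0 (lexx _)).
rewrite -(ler_pM2r (x := B^-1)) ?invr_gt0 // {2}/B => W.
rewrite [(k%:R * _ + _) * e]mulrDl addrA; apply: lerD.
  apply: (le_trans W); rewrite le_eqVlt; apply/orP; left; apply/eqP.
  by rewrite /B; field; rewrite !gt_eqF.
rewrite mulrC; apply: ler_pM; rewrite ?divr_ge0 ?normc_ge0 //.
by rewrite ler_pdivrMr // q_le.
Qed.

End Casoratian.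

(** The right-hand side of [ratio_diff_le], once the block error is
    [1 / (k + 2) ^ 2], has this shape. *)
Lemma small_eventually (R : realType) (c K1 K2 : R) (u : nat -> R) :
  0 < c -> (forall n, 0 < u n) -> (forall n, c * n%:R <= u n ^+ 2) ->
  0 <= K1 -> 0 <= K2 -> forall e, 0 < e ->
  exists N, forall n, (N <= n)%N -> K1 / u n + K2 / n.+1%:R < e.
Proof.
move=> c0 u0 grow K10 K20 e e0.
(* K1 + 1 and K2 + 1 instead of K1 and K2 keep the thresholds positive. *)
pose B := (2 * (K1 + 1) / e) ^+ 2 / c.
pose D := 2 * (K2 + 1) / e.
have B0 : 0 <= B by rewrite divr_ge0 // ?sqr_ge0 // ltW.
exists (maxn (Num.truncn B).+1 (Num.truncn D).+1) => n.
rewrite geq_max => /andP[nB nD].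
have hB : B < n%:R by apply: lt_le_trans (truncnS_gt B) _; rewrite ler_nat.
have hD : D < n%:R by apply: lt_le_trans (truncnS_gt D) _; rewrite ler_nat.
have h1 : K1 / u n <= e / 2.
  rewrite ler_pdivrMr // mulrAC ler_pdivlMr //.
  have uB : 2 * (K1 + 1) / e < u n.
    have X0 : 0 <= 2 * (K1 + 1) / e by apply: divr_ge0; lra.
    rewrite -(@ltr_pXn2r _ 2) ?nnegrE ?(ltW (u0 n)) //.
    apply: lt_le_trans (grow n); move: hB.
    by rewrite /B ltr_pdivrMr // [n%:R * c]mulrC.
  move: uB; rewrite ltr_pdivrMr // => uB; lra.
have h2 : K2 / n.+1%:R < e / 2.
  rewrite ltr_pdivrMr ?ltr0n // mulrAC ltr_pdivlMr //.
  have : D < n.+1%:R by apply: lt_le_trans hD _; rewrite ler_nat.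
  rewrite /D ltr_pdivrMr // => ?; lra.
by rewrite [ltRHS]splitr ler_ltD.
Qed.

(** * The support of a probability measure on the line *)

Lemma ae_forall_count (d : measure_display) (T : measurableType d)
    (R : realType) (P : {measure set T -> \bar R}) (I : countType)
    (Q : I -> T -> Prop) :
  (forall i, {ae P, forall w, Q i w}) -> {ae P, forall w, forall i, Q i w}.
Proof.
move=> aQ.
have : {ae P, forall w, forall k : nat,
    if unpickle k is Some i then Q i w else True}.
  by apply: ae_foralln => k; case: unpickle => [i|]; [exact: aQ|exact: aeW].
by apply: filterS => w Qw i; have := Qw (pickle i); rewrite pickleK.
Qed.

Lemma measurable_ballR (R : realType) (x r : R) :
  measurable (ball x r : set (measurableTypeR R)).
Proof. by rewrite ball_itv; exact: measurable_itv. Qed.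

Lemma ex_invn_lt (R : realType) (e : R) : 0 < e ->
  exists n, (n.+1%:R^-1 : R) < e.
Proof.
move=> e0; exists (Num.truncn e^-1).
by rewrite -[ltRHS]invrK ltf_pV2 ?posrE ?invr_gt0 // truncnS_gt.
Qed.

Lemma rat_approx (R : realType) (x r : R) : 0 < r ->
  exists q : rat, `|x - ratr q| < r.
Proof.
move=> r0.
have [q] : exists q : rat, ratr q \in `]x, (x + r)[.
  by apply: rat_in_itvoo; rewrite ltrDl.
rewrite in_itv /= => /andP[xq qx]; exists q.
by rewrite ltr_norml; apply/andP; split; lra.
Qed.

(** The line is covered, outside the support, by the null balls with rational
    centre and radius of the form 1/(n+1), which are countably many. *)
Lemma supp_ae (R : realType) (mu : probabilityR R) :
  {ae mu, forall x, supp mu x}.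
Proof.
pose B (i : rat * nat) : set (measurableTypeR R) :=
  ball (ratr i.1 : R) i.2.+1%:R^-1.
have mB i : measurable (B i) by exact: measurable_ballR.
have : {ae mu, forall x, forall i, mu (B i) = 0%E -> ~ B i x}.
  apply: ae_forall_count => i.
  have [m0|m0] := pselect (mu (B i) = 0%E); last by apply: aeW => x /m0.
  exists (B i); split => // x /= H; apply: contrapT => Bx; exact: H.
apply: filterS => x Hx e e0; rewrite lt_neqAle measure_ge0 andbT eq_sym.
apply/negP => /eqP mu0.
have [n ne] : exists n, (n.+1%:R^-1 : R) < e / 2.
  by apply: ex_invn_lt; rewrite divr_gt0.
have [q xq] : exists q : rat, `|x - ratr q| < (n.+1%:R^-1 : R).
  by apply: rat_approx; rewrite invr_gt0.
apply: (Hx (q, n)); last by rewrite /B /ball /= distrC.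
apply: (subset_measure0 (mB _) _ _ mu0); first exact: measurable_ballR.
move=> y; rewrite /B /ball /= => qy.
apply: le_lt_trans (ler_distD (ratr q) _ _) _.
by rewrite [e]splitr; apply: ltrD; [exact: lt_trans ne|exact: lt_trans ne].
Qed.

Lemma supp_le_radius (R : realType) (mu : probabilityR R) x :
  compact (supp mu) -> supp mu x -> `|x| <= supp_radius mu.
Proof.
move=> /compact_bounded[M [_ HM]] mx; rewrite /supp_radius; apply: ub_le_sup.
  by exists (M + 1) => _ [y my <-]; apply: HM => //; rewrite ltrDl.
by exists x.
Qed.

Lemma supp_radius_measure0 (R : realType) (mu : probabilityR R) :
  compact (supp mu) -> mu (~` `[- supp_radius mu, supp_radius mu]) = 0%E.
Proof.
move=> cs; apply/negligibleP.
  by apply: measurableC; exact: measurable_itv.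
refine (@negligibleS _ _ _ mu _ _ _ (supp_ae mu)); apply: subsetC => x mx.
by rewrite /= in_itv /= -ler_norml supp_le_radius.
Qed.

Lemma supp_ball (R : realType) (tau : probabilityR R) (x y r : R) :
  supp tau x -> `|x - y| < r -> (0 < tau (ball y r))%E.
Proof.
move=> sx xy; apply: lt_le_trans (sx (r - `|x - y|) _) _.
  by rewrite subr_gt0.
apply: le_measure; rewrite ?inE; try exact: measurable_ballR.
move=> t; rewrite /ball /= ltrBrDr => xt.
by apply: le_lt_trans (ler_distD x _ _) _; rewrite [`|y - x|]distrC addrC.
Qed.

(** A support is closed: if it avoids 0, it avoids a ball around 0. *)
Lemma supp_lower (R : realType) (tau : probabilityR R) :
  supp tau `<=` [set x | 0 < x] ->
  exists2 alpha : R, 0 < alpha & forall x, supp tau x -> alpha <= x.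
Proof.
move=> pos.
have [e /not_implyP[e0 H]] : exists e : R,
    ~ ((0 < e)%R -> (0 < tau (ball (0%R : R) e))%E).
  by apply/existsNP => H; have := pos 0 H; rewrite /= ltxx.
exists e => // x sx; rewrite leNgt; apply/negP => xe; apply: H.
by apply: (supp_ball sx); rewrite subr0 gtr0_norm // (pos x sx).
Qed.

(** * The sesquilinear form of a measure on polynomials *)

Section Moments.
Variables (R : realType) (mu : probabilityR R) (rho : R).
Hypothesis mu_rho : mu (~` `[- rho, rho]) = 0%E.

Let mf (f : {poly R}) (A : set (measurableTypeR R)) :
  measurable_fun A (horner f).
Proof. exact: measurable_poly. Qed.

Let mN : measurable (~` `[- rho, rho] : set (measurableTypeR R)).
Proof. by apply: measurableC; exact: measurable_itv. Qed.

Lemma integrable_horner (f : {poly R}) :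
  mu.-integrable setT (EFin \o horner f).
Proof.
apply: (iffRL (negligible_integrable (D := setT) mN _ _ mu_rho)) => //.
  exact/measurable_EFinP.
rewrite setTD setCK; apply: measurable_bounded_integrable => //.
  by rewrite (le_lt_trans (probability_le1 _ _)) ?ltry.
exists (\sum_(i < size f) `|f`_i| * `|rho| ^+ i); split; first exact: num_real.
move=> y hy x; rewrite /= in_itv /= -ler_norml => xr.
apply: le_trans (ltW hy); rewrite horner_coef.
apply: (le_trans (ler_norm_sum _ _ _)); apply: ler_sum => i _.
rewrite normrM normrX ler_wpM2l // lerXn2r ?nnegrE //.
exact: le_trans xr (ler_norm _).
Qed.

Lemma moment_ge0 (f : {poly R}) : (forall x, `|x| <= rho -> 0 <= f.[x]) ->
  0 <= \int[mu]_(x in setT) f.[x].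
Proof.
move=> f0; rewrite /Rintegral (negligible_integral mN _ _ mu_rho) //.
  rewrite setTD setCK; apply: fine_ge0; apply: integral_ge0 => x.
  by rewrite /= in_itv /= -ler_norml lee_fin => /f0.
exact: integrable_horner.
Qed.

Let I (f : {poly R}) : R := \int[mu]_(x in setT) f.[x].

Let I_lin c (f g : {poly R}) : I (c%:P * f + g) = c * I f + I g.
Proof.
rewrite /I -RintegralZl //; last exact: integrable_horner.
rewrite -RintegralD //; last 2 first.
- have -> : (fun x => c * f.[x]) = horner (c%:P * f).
    by apply/funext => x; rewrite !hornerE.
  exact: integrable_horner.
- exact: integrable_horner.
by apply: eq_Rintegral => x _; rewrite !hornerE.
Qed.

Let I0 : I 0 = 0.
Proof. by have := I_lin (-1) 0 0; rewrite mulr0 addr0 mulN1r addNr. Qed.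

Let ID f g : I (f + g) = I f + I g.
Proof. by have := I_lin 1 f g; rewrite !mul1r. Qed.

Let IZ c f : I (c%:P * f) = c * I f.
Proof. by have := I_lin c f 0; rewrite I0 !addr0. Qed.

Let IN f : I (- f) = - I f.
Proof. by have := IZ (-1) f; rewrite polyCN mulNr mul1r mulN1r. Qed.

(** On the real line a complex polynomial is a pair of real polynomials, which
    reduces every property of the form below to linearity and positivity of
    the real integral. *)
Let re_im (P : {poly R[i]}) :
  exists f g : {poly R}, forall x, P.[x%:C] = f.[x] +i* g.[x].
Proof.
elim/poly_ind: P => [|P c [f [g Pfg]]].
  by exists 0, 0 => x; rewrite !horner0.
exists (f * 'X + (complex.Re c)%:P), (g * 'X + (complex.Im c)%:P) => x.
by rewrite !hornerE Pfg; case: c => u v; simpc.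
Qed.

Definition l2_form (P Q : {poly R[i]}) : R[i] :=
  integralC mu (fun x => P.[x%:C] * (Q.[x%:C])^*%C).

Let formE (P Q : {poly R[i]}) (f g f' g' : {poly R}) :
  (forall x, P.[x%:C] = f.[x] +i* g.[x]) ->
  (forall x, Q.[x%:C] = f'.[x] +i* g'.[x]) ->
  l2_form P Q = I (f * f' + g * g') +i* I (g * f' - f * g').
Proof.
move=> PE QE; congr (_ +i* _); apply: eq_Rintegral => x _;
  by rewrite PE QE !hornerE /=; ring.
Qed.

Lemma l2_form_linear c P P' Q :
  l2_form (c *: P + P') Q = c * l2_form P Q + l2_form P' Q.
Proof.
have [f [g PE]] := re_im P; have [f' [g' PE']] := re_im P'.
have [h [k QE]] := re_im Q.
case: c => u v.
rewrite (formE PE QE) (formE PE' QE).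
rewrite (@formE _ _ (u%:P * f - v%:P * g + f') (u%:P * g + v%:P * f + g')
  _ _ _ QE); last first.
  by move=> x; rewrite !hornerE PE PE'; simpc.
have -> : (u%:P * f - v%:P * g + f') * h + (u%:P * g + v%:P * f + g') * k =
  u%:P * (f * h + g * k)
  + (- (v%:P * (g * h - f * k)) + (f' * h + g' * k)) by ring.
have -> : (u%:P * g + v%:P * f + g') * h - (u%:P * f - v%:P * g + f') * k =
  u%:P * (g * h - f * k)
  + (v%:P * (f * h + g * k) + (g' * h - f' * k)) by ring.
rewrite I_lin [I (- _ + _)]ID IN IZ [in X in _ +i* X]I_lin I_lin.
by simpc; rewrite !addrA.
Qed.

Lemma l2_form_conj P Q : l2_form Q P = (l2_form P Q)^*%C.
Proof.
have [f [g PE]] := re_im P; have [f' [g' QE]] := re_im Q.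
by rewrite (formE PE QE) (formE QE PE) /= -IN; congr (I _ +i* I _); ring.
Qed.

(** Multiplication by the variable is symmetric because the line is real. *)
Lemma l2_form_X P Q : l2_form ('X * P) Q = l2_form P ('X * Q).
Proof.
congr integralC; apply/funext => x.
rewrite !hornerE; case: P.[_] => u v; case: Q.[_] => s t.
rewrite /= !(mul0r, subr0, addr0); apply/eqP; rewrite eq_complex /=.
by apply/andP; split; apply/eqP; ring.
Qed.

(** The operator of multiplication by x has its numerical range in
    [-rho, rho]: both (rho - x) |P|^2 and (rho + x) |P|^2 are nonnegative
    there. *)
Lemma l2_form_bound P :
  normc (l2_form ('X * P) P) <= rho * normc (l2_form P P).
Proof.
have [f [g PE]] := re_im P.
rewrite (formE PE PE) (@formE _ _ ('X * f) ('X * g) _ _ _ PE); last first.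
  by move=> x; rewrite !hornerE PE; simpc.
have -> : g * f - f * g = 0 by ring.
have -> : 'X * g * f - 'X * f * g = 0 by ring.
have -> : 'X * f * f + 'X * g * g = 'X * (f * f + g * g) by ring.
rewrite I0 /normc expr0n /= !addr0 !sqrtr_sqr.
have w0 x : 0 <= (f * f + g * g).[x].
  by rewrite !hornerE -!expr2 addr_ge0 ?sqr_ge0.
set w := f * f + g * g in w0 *.
have Iw : 0 <= I w by apply: moment_ge0.
rewrite (ger0_norm Iw) ler_norml; apply/andP; split.
  rewrite -subr_ge0 opprK -IZ -ID; apply: moment_ge0 => x xr.
  rewrite hornerD hornerCM hornerM hornerX -mulrDl mulr_ge0 //.
  by move: xr; rewrite ler_norml => /andP[? ?]; lra.
rewrite -subr_ge0 -IZ -IN -ID; apply: moment_ge0 => x xr.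
rewrite hornerD hornerN hornerCM hornerM hornerX -mulrBl mulr_ge0 //.
by move: xr; rewrite ler_norml => /andP[? ?]; lra.
Qed.

End Moments.

(** * Orthonormal polynomials for a form in which the variable is symmetric *)

Section Orthonormal.
Variables (R : realType) (ip : {poly R[i]} -> {poly R[i]} -> R[i]).
Hypothesis ipP :
  forall c P P' Q, ip (c *: P + P') Q = c * ip P Q + ip P' Q.
Hypothesis ipC : forall P Q, ip Q P = (ip P Q)^*%C.
Hypothesis ipX : forall P Q, ip ('X * P) Q = ip P ('X * Q).
Variable rho : R.
Hypothesis ip_bound :
  forall P, normc (ip ('X * P) P) <= rho * normc (ip P P).

Variables (p : nat -> {poly R[i]}) (a b : nat -> R).
Hypothesis size_p : forall n, size (p n) = n.+1.
Hypothesis ip_p : forall m n, ip (p n) (p m) = (m == n)%:R.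
Hypothesis jac_diag : forall n, ip ('X * p n) (p n) = (b n)%:C.
Hypothesis jac_up : forall n, ip ('X * p n) (p n.+1) = (a n)%:C.
Hypothesis jac_down : forall n, ip ('X * p n.+1) (p n) = (a n)%:C.

Let ip0 Q : ip 0 Q = 0.
Proof.
have := ipP (-1) 0 0 Q.
by rewrite scaler0 addr0 mulN1r addNr.
Qed.

Let ipZ c P Q : ip (c *: P) Q = c * ip P Q.
Proof. by rewrite -[c *: P]addr0 ipP ip0 addr0. Qed.

Let ipD P P' Q : ip (P + P') Q = ip P Q + ip P' Q.
Proof. by rewrite -{1}[P]scale1r ipP mul1r. Qed.

Let ipB P P' Q : ip (P - P') Q = ip P Q - ip P' Q.
Proof. by rewrite ipD -scaleN1r ipZ mulN1r. Qed.

Let ip_sum n (F : 'I_n -> {poly R[i]}) Q :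
  ip (\sum_i F i) Q = \sum_i ip (F i) Q.
Proof. by apply: (big_morph (ip^~ Q)) => // P P'; exact: ipD. Qed.

Let span n (P : {poly R[i]}) : (size P <= n)%N ->
  exists c : 'I_n -> R[i], P = \sum_(i < n) c i *: p i.
Proof.
elim: n P => [|n IHn] P sP.
  by exists (fun=> 0); rewrite big_ord0; apply/size_poly_leq0P.
have ln : lead_coef (p n) != 0 by rewrite lead_coef_eq0 -size_poly_gt0 size_p.
set c := P`_n / lead_coef (p n).
have [|d Pd] := IHn (P - c *: p n).
  apply/leq_sizeP => j; rewrite leq_eqVlt => /orP[/eqP <-|nj].
    rewrite coefB coefZ /c [lead_coef _]lead_coefE size_p /= divfK ?subrr //.
    by rewrite lead_coefE size_p in ln.
  rewrite coefB coefZ !nth_default ?mulr0 ?subrr ?size_p //.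
  exact: leq_trans sP nj.
exists (fun i : 'I_n.+1 => if unlift ord_max i is Some j then d j else c).
rewrite big_ord_recr /= unlift_none; apply/eqP; rewrite -subr_eq Pd.
apply/eqP/eq_bigr => i _.
have -> : widen_ord (leqnSn n) i = lift ord_max i.
  by apply/val_inj; rewrite /= /bump leqNgt ltn_ord.
by rewrite liftK.
Qed.

Let ip_pN (n : nat) (i j : 'I_n) : j != i -> ip (p j) (p i) = 0.
Proof.
by move=> ji; rewrite ip_p eq_sym (_ : (_ == _) = false) //; apply/negbTE.
Qed.

Lemma orthonormal_expansion n (P : {poly R[i]}) : (size P <= n)%N ->
  P = \sum_(i < n) ip P (p i) *: p i.
Proof.
move=> /span[c ->]; apply: eq_bigr => i _; congr (_ *: _).
rewrite ip_sum (bigD1 i) //= ipZ ip_p eqxx mulr1 big1 ?addr0 // => j ji.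
by rewrite ipZ ip_pN // mulr0.
Qed.

Let ip_small n (P : {poly R[i]}) : (size P <= n)%N -> ip P (p n) = 0.
Proof.
move=> /orthonormal_expansion ->; rewrite ip_sum big1 // => i _.
by rewrite ipZ ip_p gtn_eqF ?mulr0.
Qed.

Let size_Xp n : size ('X * p n) = n.+2.
Proof. by rewrite mulrC size_mulX ?size_p // -size_poly_gt0 size_p. Qed.

Lemma three_term0 : 'X * p 0%N = (a 0%N)%:C *: p 1%N + (b 0%N)%:C *: p 0%N.
Proof.
rewrite [LHS](orthonormal_expansion (n := 2)) ?size_Xp //.
by rewrite !big_ord_recr big_ord0 /= add0r jac_diag jac_up addrC.
Qed.

(** The coefficients of ['X * p n.+1] on [p i] with [i < n] vanish: moving the
    variable to the other side leaves a polynomial of degree at most [n]. *)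
Lemma three_term n : 'X * p n.+1 =
  (a n.+1)%:C *: p n.+2 + (b n.+1)%:C *: p n.+1 + (a n)%:C *: p n.
Proof.
rewrite [LHS](orthonormal_expansion (n := n.+3)) ?size_Xp //.
rewrite !big_ord_recr /= jac_diag jac_up jac_down big1 => [|i _].
  by rewrite add0r addrC [X in _ + X]addrC addrA.
rewrite -[LHS]/(ip ('X * p n.+1) (p i) *: p i).
by rewrite ipX ipC ip_small ?conjc0 ?scale0r // size_Xp ltnS ltn_ord.
Qed.

(** Polarization: apply the bound on the quadratic form to
    [p n + p n.+1] and [p n - p n.+1]. *)
Lemma jacobi_offdiag_le n : `|a n| <= rho.
Proof.
have ip_n : ip (p n) (p n) = 1 by rewrite ip_p eqxx.
have ip_n1 : ip (p n.+1) (p n.+1) = 1 by rewrite ip_p eqxx.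
have ip_u : ip (p n) (p n.+1) = 0 by rewrite ip_p gtn_eqF.
have ip_d : ip (p n.+1) (p n) = 0 by rewrite ip_p ltn_eqF.
have ipDr P Q Q' : ip P (Q + Q') = ip P Q + ip P Q'.
  by rewrite ipC ipD rmorphD /= -!ipC.
have ipBr P Q Q' : ip P (Q - Q') = ip P Q - ip P Q'.
  by rewrite ipC ipB rmorphB /= -!ipC.
have := ip_bound (p n + p n.+1); have := ip_bound (p n - p n.+1).
rewrite mulrBr mulrDr !ipB !ipD !ipBr !ipDr ip_n ip_n1 ip_u ip_d.
rewrite !jac_diag jac_up jac_down.
have -> : 1 - 0 - (0 - 1) = (2 : R)%:C by rewrite rmorphMn /= rmorph1; ring.
have -> : 1 + 0 + (0 + 1) = (2 : R)%:C by rewrite rmorphMn /= rmorph1; ring.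
have -> : (b n)%:C - (a n)%:C - ((a n)%:C - (b n.+1)%:C) =
  (b n + b n.+1 - 2 * a n)%:C by simpc; congr (_ +i* _); ring.
have -> : (b n)%:C + (a n)%:C + ((a n)%:C + (b n.+1)%:C) =
  (b n + b n.+1 + 2 * a n)%:C by simpc; congr (_ +i* _); ring.
rewrite !normc_real !(@ger0_norm _ 2) //.
rewrite !ler_norml => /andP[h1 h2] /andP[h3 h4]; apply/andP; split; lra.
Qed.

Variable z : R[i].
Local Notation ev k := (p k).[z].

Lemma three_term_eval n : z * ev n.+1 =
  (a n.+1)%:C * ev n.+2 + (b n.+1)%:C * ev n.+1 + (a n)%:C * ev n.
Proof. by have := congr1 (horner^~ z) (three_term n); rewrite !hornerE. Qed.

Let kernel n := \sum_(k < n) (ev k)^*%C *: p k.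

Let christoffel_darboux n : ('X - (z^*%C)%:P) * kernel n.+1 =
  (a n)%:C *: ((ev n)^*%C *: p n.+1 - (ev n.+1)^*%C *: p n).
Proof.
elim: n => [|n IHn].
  rewrite /kernel big_ord1 -scalerAr mulrBl three_term0.
  have := congr1 (horner^~ z) three_term0; rewrite !hornerE.
  move=> /(congr1 (@conjc R)).
  rewrite !rmorphM rmorphD !rmorphM /= !oppr0 => E.
  rewrite mul_polyC scalerBr scalerA [_ * z^*%C]mulrC E.
  by rewrite -!mul_polyC !polyCD !polyCM; ring.
rewrite /kernel big_ord_recr /= mulrDr IHn -scalerAr mulrBl three_term.
have := congr1 (@conjc R) (three_term_eval n).
rewrite !rmorphM !rmorphD !rmorphM /= !oppr0 => /(congr1 polyC).
rewrite -!mul_polyC !polyCD !polyCM => E.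
(* isolate z^* times the conjugate of [ev n.+1], the left-hand side of E *)
have -> : forall c y w : {poly R[i]},
  c * (y - w * p n.+1) = c * y - w * c * p n.+1 by move=> c y w; ring.
by rewrite E; ring.
Qed.

Let ip_kernel n k : ip (p k) (kernel n) = if (k < n)%N then ev k else 0.
Proof.
rewrite ipC ip_sum; case: ltnP => [kn|nk].
  rewrite (bigD1 (Ordinal kn)) //= ipZ ip_p eqxx mulr1 big1 ?addr0 ?conjcK //.
  by move=> j ji; rewrite ipZ (ip_pN ji) mulr0.
rewrite big1 ?conjc0 // => i _.
by rewrite ipZ ip_p gtn_eqF ?mulr0 // (leq_trans (ltn_ord i)).
Qed.

(** Pair the Christoffel-Darboux identity with the kernel itself. *)
Lemma orthonormal_energy n :
  (normc z - rho) * \sum_(k < n.+1) normc (ev k) ^+ 2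
  <= rho * (normc (ev n.+1) * normc (ev n)).
Proof.
set S := \sum_(k < _) _.
have S0 : 0 <= S by apply: sumr_ge0 => i _; exact: sqr_ge0.
have KK : ip (kernel n.+1) (kernel n.+1) = S%:C.
  rewrite {1}/kernel ip_sum /S rmorph_sum /=; apply: eq_bigr => i _.
  by rewrite ipZ ip_kernel ltn_ord mulrC mulc_conj.
have := congr1 (ip^~ (kernel n.+1)) (christoffel_darboux n).
rewrite mulrBl ipB mul_polyC ipZ KK ipZ ipB !ipZ !ip_kernel.
rewrite ltnn ltnSn mulr0 sub0r.
set x := ip _ _; set w := _ * - _ => E.
have {}E : z^*%C * S%:C = x - w by rewrite -E subKr.
have : normc (z^*%C * S%:C) <=
    rho * S + rho * (normc (ev n.+1) * normc (ev n)).
  rewrite E; apply: (le_trans (le_normcD _ _)); apply: lerD.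
    by have := ip_bound (kernel n.+1); rewrite KK normc_real ger0_norm.
  rewrite normcN /w normcM normcN normcM normc_real normc_conj ler_wpM2r //.
    by rewrite mulr_ge0 // normc_ge0.
  exact: jacobi_offdiag_le.
by rewrite normcM normc_conj normc_real ger0_norm // mulrBl lerBlDl.
Qed.

End Orthonormal.

(** * Values of the orthonormal polynomials of a measure *)

Section OrthogonalPolynomials.
Variables (R : realType) (mu : probabilityR R) (a b : nat -> R).
Hypothesis jac : jacobi_parameters mu a b.
Hypothesis a_neq0 : exists n, a n != 0.

(** If no orthonormal sequence existed, [opoly mu] would be the default value
    0 and all the entries of the Jacobi matrix would vanish. *)
Lemma opoly_orthonormal : orthonormal_polys mu (opoly mu).
Proof.
have [n an] := a_neq0; have [_ _ _ jn _] := jac.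
rewrite /opoly; case: xgetP => [p -> //|noP].
have opE : opoly mu = fun=> 0 by rewrite /opoly; case: xgetP => // p _ /noP.
move: (jn n) an; rewrite /jacobi_mx opE /integralC.
rewrite (_ : (fun x => _) = fun=> 0); last first.
  by apply/funext => x; rewrite horner0 !(mulr0, mul0r).
rewrite (_ : (fun x => _) = fun=> 0); last first.
  by apply/funext => x; rewrite horner0 !(mulr0, mul0r).
by rewrite !Rintegral_cst // !mul0r => -[<-]; rewrite eqxx.
Qed.

Let cs : compact (supp mu). Proof. by case: jac. Qed.
Let rho := supp_radius mu.
Let mu_rho := supp_radius_measure0 cs.

Let jacE i j : l2_form mu ('X * opoly mu j) (opoly mu i) = jacobi_mx mu i j.
Proof. by congr integralC; apply/funext => x; rewrite hornerM hornerX. Qed.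

Let jd n : l2_form mu ('X * opoly mu n) (opoly mu n) = (b n)%:C.
Proof. by rewrite jacE; case: jac => _ _ h _ _; exact: h. Qed.

Let ju n : l2_form mu ('X * opoly mu n) (opoly mu n.+1) = (a n)%:C.
Proof. by rewrite jacE; case: jac => _ _ _ h _; exact: h. Qed.

Let jw n : l2_form mu ('X * opoly mu n.+1) (opoly mu n) = (a n)%:C.
Proof. by rewrite jacE; case: jac => _ _ _ _ h; exact: h. Qed.

Let sz n : size (opoly mu n) = n.+1.
Proof. by case: opoly_orthonormal => h _ _; exact: h. Qed.

Let on m n : l2_form mu (opoly mu n) (opoly mu m) = (m == n)%:R.
Proof. by case: opoly_orthonormal => _ _ h; exact: h. Qed.

Let lin := l2_form_linear mu_rho.
Let conj := l2_form_conj mu_rho.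
Let symX := l2_form_X mu.
Let bound := l2_form_bound mu_rho.

Lemma opoly_three_term z n : z * (opoly mu n.+1).[z] =
  (a n.+1)%:C * (opoly mu n.+2).[z] + (b n.+1)%:C * (opoly mu n.+1).[z]
  + (a n)%:C * (opoly mu n).[z].
Proof. exact: (three_term_eval lin conj symX sz on jd ju jw). Qed.

Lemma jacobi_offdiag_le_radius n : `|a n| <= rho.
Proof. exact: (jacobi_offdiag_le lin conj bound on jd ju jw). Qed.

Variable z : R[i].
Hypothesis z_out : rho < normc z.

Let u k := normc (opoly mu k).[z].

Let energy n : (normc z - rho) * \sum_(k < n.+1) u k ^+ 2 <=
  rho * (u n.+1 * u n).
Proof. exact: (orthonormal_energy lin conj symX bound sz on jd ju jw). Qed.

Let gap : 0 < normc z - rho. Proof. by rewrite subr_gt0. Qed.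

Let rho0 : 0 <= rho.
Proof. exact: le_trans (jacobi_offdiag_le_radius 0). Qed.

Let u_ge0 k : 0 <= u k. Proof. exact: normc_ge0. Qed.

Let u0 : 0 < u 0.
Proof.
have /size_poly1P[c c0 pE] : size (opoly mu 0) == 1%N by rewrite sz.
rewrite /u pE hornerC lt_neqAle normc_ge0 andbT eq_sym.
by apply: contra c0 => /eqP/eq0_normc ->.
Qed.

Lemma opoly_eval_gt0 n : 0 < normc (opoly mu n).[z].
Proof. exact: (energy_gt0 (u := u) gap u0 u_ge0 energy). Qed.

Lemma opoly_eval_le : exists2 C : R, 0 < C & forall i j, (i <= j)%N ->
  normc (opoly mu i).[z] <= C * normc (opoly mu j).[z].
Proof.
exists (1 + rho / (normc z - rho)).
  by rewrite ltr_wpDr // divr_ge0 // ltW.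
by move=> i j; exact: (energy_le (u := u) gap rho0 u0 u_ge0 energy).
Qed.

Lemma opoly_eval_growth : exists2 c : R, 0 < c &
  forall n, c * n%:R <= normc (opoly mu n).[z] ^+ 2.
Proof. exact: (energy_growth (u := u) gap rho0 u0 u_ge0 energy). Qed.

End OrthogonalPolynomials.

(** * Independent blocks of the random parameters *)

Section SecondBorelCantelli.
Context (d : measure_display) (T : measurableType d) (R : realType).
Variables (P : probability T R) (E : nat -> set T) (q : R).
Hypothesis mE : forall j, measurable (E j).
Hypothesis q0 : 0 < q.
Hypothesis P_E : forall s : seq nat, uniq s ->
  P (\big[setI/setT]_(j <- s) E j) = (q ^+ size s)%:E.

(** Complements of independent events are independent: remove the events of
    [t] one at a time, each by P(X minus E) = P(X) - P(X and E). *)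
Let avoid t s : uniq (t ++ s) ->
  P (\big[setI/setT]_(j <- t) ~` E j `&` \big[setI/setT]_(j <- s) E j)
  = ((1 - q) ^+ size t * q ^+ size s)%:E.
Proof.
have mcap (F : nat -> set T) r : (forall j, measurable (F j)) ->
    measurable (\big[setI/setT]_(j <- r) F j).
  by move=> mF; elim/big_ind: _ => //; exact: measurableI.
elim: t s => [|j t IHt] s us.
  by rewrite big_nil setTI expr0 mul1r P_E.
have ujs : uniq (t ++ j :: s).
  rewrite (perm_uniq (_ : perm_eq _ (j :: t ++ s))) //.
  by rewrite perm_catC /= perm_cons perm_catC.
have us' : uniq (t ++ s) by move: us => /= /andP[].
rewrite big_cons.
set X := \big[setI/setT]_(i <- t) _; set Y := \big[setI/setT]_(i <- s) _.
have -> : ~` E j `&` X `&` Y = (X `&` Y) `\` E j.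
  by apply/seteqP; split => x /= => [[[]]|[[]]].
have mX : measurable X by apply: mcap => i; exact: measurableC.
have mY : measurable Y by exact: mcap.
have mXY : measurable (X `&` Y) by exact: measurableI.
rewrite measureD //; last by rewrite -ge0_fin_numE ?fin_num_measure.
have -> : X `&` Y `&` E j = X `&` \big[setI/setT]_(i <- j :: s) E i.
  by rewrite big_cons -/Y -setIA [Y `&` _]setIC.
rewrite [X in (X - _)%E](IHt _ us') [X in (_ - X)%E](IHt _ ujs).
by rewrite -EFinB; congr EFin; rewrite /= !exprS; ring.
Qed.

Lemma second_borel_cantelli : {ae P, forall w, exists j, E j w}.
Proof.
have mA : measurable (\bigcap_j ~` E j).
  by apply: bigcap_measurable => //j _; exact: measurableC.
exists (\bigcap_j ~` E j); split => //; last first.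
  by move=> w /= /forallNP Hw j _; exact: Hw.
have leK K : (P (\bigcap_j ~` E j) <= ((1 - q) ^+ K)%:E)%E.
  have := @avoid (iota 0 K) [::].
  rewrite cats0 iota_uniq big_nil setIT size_iota expr0 mulr1.
  move=> /(_ isT) <-; apply: le_measure; rewrite ?inE //.
    elim/big_ind: _ => //; first exact: measurableI.
    by move=> i _; exact: measurableC.
  by rewrite -bigcap_seq => w Hw j _; exact: Hw.
have q1 : q <= 1.
  have := P_E (s := [:: 0%N]) isT; rewrite big_seq1 expr1 -lee_fin => <-.
  exact: probability_le1.
apply/eqP; rewrite eq_le measure_ge0 andbT.
apply/lee_addgt0Pr => e e0; rewrite add0e.
have : (fun n => (1 - q) ^+ n) @ \oo --> (0 : R).
  apply: cvg_expr; rewrite ltr_norml; apply/andP; split.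
    by rewrite ltrBDl; move: q0 q1; lra.
  by rewrite ltrBlDr ltrDl.
move=> /cvgrPdist_lt /(_ e e0) [N _ /(_ N (leqnn N))] /=.
rewrite sub0r normrN => HN; apply: (le_trans (leK N)); rewrite lee_fin ltW //.
exact: le_lt_trans (ler_norm _) HN.
Qed.

End SecondBorelCantelli.

Lemma uniq_flatten_map (S T : eqType) (J : S -> seq T) (g : T -> S)
    (s : seq S) :
  uniq s -> (forall j, uniq (J j)) -> (forall j i, i \in J j -> g i = j) ->
  uniq (flatten (map J s)).
Proof.
move=> us uJ gJ; elim: s us => //= j s IHs /andP[js us].
rewrite cat_uniq uJ IHs // andbT /=.
apply/hasPn => i /flattenP[_ /mapP[k ks ->] ik].
by apply/negP => ij; move: js; rewrite -(gJ _ _ ij) (gJ _ _ ik) ks.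
Qed.

Section Blocks.
Variables (R : realType) (d : measure_display) (T : measurableType d).
Variables (P : probability T R) (tau1 tau2 : probabilityR R).
Variables (a b : nat -> {RV P >-> measurableTypeR R}).
Hypothesis a_law :
  forall n A, measurable A -> distribution P (a n) A = tau1 A.
Hypothesis b_law :
  forall n A, measurable A -> distribution P (b n) A = tau2 A.
Hypothesis ab_indep : mutually_independent (sum_fam a b).

(** The positions M = L + n j, for j = 0, 1, ..., give disjoint blocks. The
    same pattern being looked for in each of them, the events to be met by
    single parameters are n-periodic in the index, which is how [B] is
    defined. *)
Lemma block_hit (n L : nat) (U V : nat -> set (measurableTypeR R)) :
  (0 < n)%N ->
  (forall i, measurable (U i)) -> (forall i, measurable (V i)) ->
  (forall i, (i < n)%N -> (0 < tau1 (U i))%E) ->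
  (forall i, (i < n)%N -> (0 < tau2 (V i))%E) ->
  {ae P, forall w, exists2 M, (L <= M)%N &
     forall i, (i < n)%N -> U i (a (M + i)%N w) /\ V i (b (M + i)%N w)}.
Proof.
move=> n0 mU mV U0 V0.
pose X := sum_fam a b.
pose B (i : nat + nat) :=
  match i with inl m => U ((m - L) %% n)%N | inr m => V ((m - L) %% n)%N end.
have mB i : measurable (B i) by case: i => m; [exact: mU|exact: mV].
pose J j : seq (nat + nat) :=
  [seq inl m | m <- iota (L + n * j) n] ++
  [seq inr m | m <- iota (L + n * j) n].
pose g (i : nat + nat) := match i with inl m | inr m => ((m - L) %/ n)%N end.
pose E j := \big[setI/setT]_(i <- J j) (X i @^-1` B i).
have gJ j i : i \in J j -> g i = j.
  rewrite mem_cat => /orP[] /mapP[m]; rewrite mem_iota => /andP[Lm mL] -> /=.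
    have -> : (m - L = j * n + (m - (L + n * j)))%N by lia.
    by rewrite divnMDl // divn_small ?addn0 //; lia.
  have -> : (m - L = j * n + (m - (L + n * j)))%N by lia.
  by rewrite divnMDl // divn_small ?addn0 //; lia.
have uJ j : uniq (J j).
  rewrite cat_uniq !map_inj_uniq ?iota_uniq ?andbT /=;
    [|by move=> ? ? []|by move=> ? ? []].
  by apply/hasPn => _ /mapP[m _ ->]; apply/mapP => -[].
have modE j i : (i < n)%N -> ((L + n * j + i - L) %% n = i)%N.
  move=> ni; have -> : (L + n * j + i - L = j * n + i)%N by lia.
  by rewrite modnMDl modn_small.
have mX s : measurable (\big[setI/setT]_(i <- s) (X i @^-1` B i)).
  elim/big_ind: _ => //; first exact: measurableI.
  by move=> i _; rewrite -[X in measurable X]setTI; exact: measurable_funP.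
have P_cap s : uniq s -> P (\big[setI/setT]_(i <- s) (X i @^-1` B i)) =
    (\prod_(i <- s) P (X i @^-1` B i))%E.
  by move=> us; rewrite -ab_indep // -bigcap_seq.
pose Q : \bar R := ((\prod_(i <- iota 0 n) tau1 (U i)) *
                    (\prod_(i <- iota 0 n) tau2 (V i)))%E.
have P_block j : (\prod_(i <- J j) P (X i @^-1` B i))%E = Q.
  have iE : iota (L + n * j) n = map (addn (L + n * j)) (iota 0 n).
    by rewrite -iotaDl addn0.
  rewrite big_cat !big_map iE !big_map /=.
  congr (_ * _)%E; rewrite big_seq [RHS]big_seq; apply: eq_bigr => i;
    rewrite mem_iota => /andP[_ ni]; rewrite modE //.
    exact: a_law.
  exact: b_law.
have Q0 : (0 < Q)%E.
  by apply: mule_gt0; rewrite big_seq; elim/big_ind: _ => // [x y|i];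
    rewrite ?mem_iota; first [exact: mule_gt0|exact: U0|exact: V0].
have QE : Q = (fine Q)%:E.
  by rewrite fineK // -(P_block 0%N) -P_cap // fin_num_measure.
have mE j : measurable (E j) by exact: mX.
have q0 : 0 < fine Q by rewrite -lte_fin -QE.
have PE s : uniq s ->
    P (\big[setI/setT]_(j <- s) E j) = ((fine Q) ^+ size s)%:E.
  move=> us; rewrite /E.
  rewrite -(big_map J xpredT
    (fun r => \big[setI/setT]_(i <- r) (X i @^-1` B i))).
  rewrite -big_flatten P_cap; last exact: (uniq_flatten_map (g := g)).
  rewrite big_flatten big_map /=.
  elim: {us}s => [|j s IHs]; first by rewrite big_nil.
  by rewrite big_cons IHs P_block {1}QE -EFinM exprS.
have := second_borel_cantelli mE q0 PE; apply: filterS => w [j Ej].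
exists (L + n * j)%N; first exact: leq_addr.
move: Ej; rewrite /E -bigcap_seq => Ej i ni; split.
  have := Ej (inl (L + n * j + i)%N); rewrite /= modE //; apply.
  by rewrite mem_cat map_f // mem_iota; apply/andP; split; lia.
have := Ej (inr (L + n * j + i)%N); rewrite /= modE //; apply.
by rewrite mem_cat orbC map_f // mem_iota; apply/andP; split; lia.
Qed.

Definition shadows (w : T) := forall a' b' : nat -> R,
  (forall n, supp tau1 (a' n)) -> (forall n, supp tau2 (b' n)) ->
  forall n L e, 0 < e -> exists2 M, (L <= M)%N &
   forall i, (i < n)%N ->
     `|a (M + i)%N w - a' i| <= e /\ `|b (M + i)%N w - b' i| <= e.

(** Targets in the supports are uncountably many, so the null set is chosen
    before them: it is the union of those given by [block_hit] for balls with
    rational centres and radii 1/(m+1), one for each tuple in a countable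
    type. *)
Lemma shadows_ae : {ae P, forall w, shadows w}.
Proof.
pose r m : R := m.+1%:R^-1.
pose U (c : seq rat) m i : set (measurableTypeR R) :=
  ball (ratr (nth 0 c i) : R) (r m).
have mU c m i : measurable (U c m i) by exact: measurable_ballR.
pose Q (x : nat * nat * nat * seq rat * seq rat) w :=
  let: (n, L, m, c, c') := x in (0 < n)%N ->
  (forall i, (i < n)%N -> (0 < tau1 (U c m i))%E) ->
  (forall i, (i < n)%N -> (0 < tau2 (U c' m i))%E) ->
  exists2 M, (L <= M)%N & forall i, (i < n)%N ->
    U c m i (a (M + i)%N w) /\ U c' m i (b (M + i)%N w).
have : {ae P, forall w, forall x, Q x w}.
  apply: ae_forall_count => -[[[[n L] m] c] c'] /=.
  have [n0|] := pselect (0 < n)%N; last by move=> h; apply: aeW => w /h.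
  have [h1|] := pselect (forall i, (i < n)%N -> (0 < tau1 (U c m i))%E);
    last by move=> h; apply: aeW => w _ /h.
  have [h2|] := pselect (forall i, (i < n)%N -> (0 < tau2 (U c' m i))%E);
    last by move=> h; apply: aeW => w _ _ /h.
  have := block_hit L n0 (mU c m) (mU c' m) h1 h2.
  by apply: filterS => w Hw _ _ _; exact: Hw.
apply: filterS => w Qw a' b' sa sb n L e e0.
case: n => [|n]; first by exists L.
have [m me] : exists m, r m < e / 2 by apply: ex_invn_lt; rewrite divr_gt0.
have r0 : 0 < r m by rewrite /r invr_gt0.
have [c ca] := choice (fun i => rat_approx (a' i) r0).
have [c' cb] := choice (fun i => rat_approx (b' i) r0).
have nthE (s : nat -> rat) i : (i < n.+1)%N -> nth 0 (mkseq s n.+1) i = s i.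
  exact: nth_mkseq.
have [i ni|i ni|M LM HM] := Qw (n.+1, L, m, mkseq c n.+1, mkseq c' n.+1) isT.
- by rewrite /U nthE //; apply: supp_ball (sa i) (ca i).
- by rewrite /U nthE //; apply: supp_ball (sb i) (cb i).
exists M => // i ni; have [] := HM i ni; rewrite /U !nthE // /ball /=.
move: (ca i) (cb i); rewrite !ltr_norml !ler_norml.
move=> /andP[? ?] /andP[? ?] /andP[? ?] /andP[? ?].
by split; apply/andP; split; lra.
Qed.

End Blocks.

(** * Ratio asymptotics along a random subsequence *)

Theorem theorem4p4 (R : realType) (d : measure_display) (Omega : measurableType d)
    (P : probability Omega R)
    (tau1 tau2 : probabilityR R)
    (tau1_compact : compact (supp tau1))
    (tau1_pos : supp tau1 `<=` [set x | 0 < x])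
    (tau2_compact : compact (supp tau2))
    (a b : nat -> {RV P >-> measurableTypeR R})
    (a_law : forall n A, measurable A -> distribution P (a n) A = tau1 A)
    (b_law : forall n A, measurable A -> distribution P (b n) A = tau2 A)
    (ab_indep : mutually_independent (sum_fam a b))
    (mu : Omega -> probabilityR R)
    (mu_jacobi : {ae P, forall w, jacobi_parameters (mu w) (a^~ w) (b^~ w)}) :
  {ae P, forall w, forall nu : probabilityR R, classK tau1 tau2 nu ->
    exists2 m : nat -> nat, {homo m : i j / (i < j)%N} &
      forall z : R[i], (Num.max (supp_radius (mu w)) (supp_radius nu))%:C < `|z| ->
        (fun n => ratio (mu w) (m n) z - ratio nu n z) @ \oo --> (0 : R[i]^o)}.
Proof.
have := shadows_ae a_law b_law ab_indep.
apply: filterS2 mu_jacobi => w jmu hits nu [a' [b' [jnu sa sb]]].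
have [alpha alpha0 alpha_le] := supp_lower tau1_pos.
(* n mismatches of size eps n still add up to something that vanishes *)
pose eps n : R := (n.+1%:R ^+ 2)^-1.
have eps0 n : 0 < eps n by rewrite invr_gt0 exprn_gt0.
have hit n L : exists M, (L <= M)%N /\ forall i, (i < n)%N ->
    `|a (M + i)%N w - a' i| <= eps n /\ `|b (M + i)%N w - b' i| <= eps n.
  by have [M LM HM] := hits a' b' sa sb n L _ (eps0 n); exists M.
have [f Hf] := choice (fun x : nat * nat => hit x.1 x.2).
(* the block for k.+1 starts after m k and ends just before m k.+1 *)
pose m := fix m n := if n is k.+1 then (f (k.+1, m k) + k.+1)%N else 0%N.
have mS n : m n.+1 = (f (n.+1, m n) + n)%N.+1 by rewrite /= addnS.
exists m.
  apply: homo_ltn => [? ? ?|i]; first exact: ltn_trans.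
  rewrite mS ltnS (leq_trans _ (leq_addr _ _)) //.
  by have [] := Hf (i.+1, m i).
move=> z; rewrite ltcR => zR.
have [zmu znu] : supp_radius (mu w) < normc z /\ supp_radius nu < normc z.
  by apply/andP; rewrite -gt_max.
have a'_neq0 : exists n, a' n != 0.
  by exists 0%N; rewrite gt_eqF // (lt_le_trans alpha0) ?alpha_le.
(* some a n w lies within alpha / 2 of a' 0, which is at least alpha *)
have a_neq0 : exists n, a n w != 0.
  have alpha2 : 0 < alpha / 2 by rewrite divr_gt0.
  have [M _ /(_ 0%N isT)[H _]] := hits a' b' sa sb 1%N 0%N (alpha / 2) alpha2.
  exists (M + 0)%N; apply/eqP => aM0; move: H; rewrite aM0 sub0r normrN.
  by have := alpha_le _ (sa 0%N); have := ler_norm (a' 0%N); lra.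
have [C C0 p_le] := opoly_eval_le jmu a_neq0 zmu.
have [C' C'0 q_le] := opoly_eval_le jnu a'_neq0 znu.
have p_gt0 := opoly_eval_gt0 jmu a_neq0 zmu.
have q_gt0 := opoly_eval_gt0 jnu a'_neq0 znu.
have [c c0 grow] := opoly_eval_growth jnu a'_neq0 znu.
have a_le := jacobi_offdiag_le_radius jmu a_neq0.
have a'_le := jacobi_offdiag_le_radius jnu a'_neq0.
have A0 : 0 <= supp_radius (mu w) by exact: le_trans (a_le 0%N).
have A'0 : 0 <= supp_radius nu by exact: le_trans (a'_le 0%N).
set q := fun k => (opoly nu k).[z] in q_gt0 q_le grow *.
set K1 := (supp_radius nu * normc (q 1%N) +
           supp_radius (mu w) * normc (q 0%N)) * C.
set K2 := 3 * (C * C') + C'.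
have bound k : alpha * normc (ratio (mu w) (m k.+1) z - ratio nu k.+1 z)
    <= K1 / normc (q k.+1) + K2 / k.+2%:R.
  have [_ close] := Hf (k.+1, m k).
  have := ratio_diff_le (opoly_three_term jmu a_neq0 z)
    (opoly_three_term jnu a'_neq0 z) C0 C'0 A0 A'0 alpha0 p_le q_le p_gt0
    q_gt0 a_le a'_le (fun i => alpha_le _ (sa i)) close.
  rewrite /ratio mS => /le_trans; apply; rewrite lerD2l /eps.
  have CC : 0 <= C * C' by rewrite mulr_ge0 // ltW.
  have -> : K2 / k.+2%:R = K2 * k.+2%:R * k.+2%:R ^- 2 :> R.
    by rewrite expr2 invfM mulrA mulfK // pnatr_eq0.
  rewrite ler_pM2r ?invr_gt0 ?exprn_gt0 // /K2 [(_ + C') * _]mulrDl lerD //.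
    have X0 : 0 <= 3 * (C * C') by rewrite mulr_ge0.
    by rewrite mulrC; apply: (ler_wpM2l X0); rewrite ler_nat; lia.
  by rewrite ler_peMr ?ler1n // ltW.
apply: (iffRL (@cvgr0Pnorm_lt _ R[i]^o _ _ _ _)) => e.
rewrite ltcE => /andP[/eqP ie re].
have eE : e = (complex.Re e)%:C.
  by apply/eqP; rewrite eq_complex ie /= !eqxx.
have K10 : 0 <= K1 by rewrite !mulr_ge0 ?addr_ge0 ?mulr_ge0 ?normc_ge0 // ltW.
have K20 : 0 <= K2 by rewrite addr_ge0 ?mulr_ge0 // ltW.
have [N HN] :=
  small_eventually c0 q_gt0 grow K10 K20 (mulr_gt0 alpha0 re).
exists N.+1 => // -[//|k] /= Nk; rewrite eE ltcR -(ltr_pM2l alpha0).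
by apply: le_lt_trans (bound k) (le_lt_trans _ (HN k.+1 _)) => //; exact: ltnW.
Qed.
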